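(* Let $\beta>0$ and $m\ge1$, and let $D=\sum_{v\in V(G^n_{m,\beta})}\binom{d(v)}{2}$ be the number of pairs of adjacent half-edges in $G^n_{m,\beta}$. For any $\epsilon>0$ and $\gamma>0$ there exists $n^*$ such that for all $n\ge n^*$, \[ \Pr\left(|D-\mathbb{E}[D]|\ge n^{\frac{4+\beta}{4+2\beta}+\epsilon}\right)\le n^{-\gamma}. \]
   Context: Fix a real $\beta>0$ and a positive integer $m$. The random tree process $(G^n_{1,\beta})_{n\ge1}$ is defined as follows. $G^1_{1,\beta}$ consists of a single vertex $v_1$ and no edges. Given $G^n_{1,\beta}$ with vertices $v_1,\dots,v_n$ and directed edges $e_2,\dots,e_n$ (where $e_i$ is the edge whose tail is $v_i$), $G^{n+1}_{1,\beta}$ is obtained by adding a vertex $v_{n+1}$ and a directed edge $e_{n+1}$ with tail $v_{n+1}$ and head a ''target vertex'' determined by a random variable $f_{n+1}$, independent of $f_2,\dots,f_n$, taking values in $\Omega_{n+1}=\{(i,v):1\le i\le n\}\cup\{(i,h),(i,t):2\le i\le n\}$ with $\Pr(f_{n+1}=(i,v))=\beta/((2+\beta)n-2)$ and $\Pr(f_{n+1}=(i,h))=\Pr(f_{n+1}=(i,t))=1/((2+\beta)n-2)$. If $f_{n+1}=(i,v)$ the target is $v_i$ (chosen ''uniformly''); if $f_{n+1}=(i,h)$ the target is the head of $e_i$, and if $f_{n+1}=(i,t)$ the target is the tail $v_i$ of $e_i$ (chosen ''preferentially'', by copying the head half-edge, resp. tail half-edge, of $e_i$). Consequently the target is $v_i$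 with probability $(d_n(v_i)+\beta)/((2+\beta)n-2)$, where $d_n(v)$ is the degree of $v$ in $G^n_{1,\beta}$. Each edge is regarded as two half-edges, one at each endpoint; the degree of a vertex is the number of half-edges at it (loops count twice). For $n\ge1$, $G^n_{m,\beta}$ is the undirected multigraph obtained from $G^{nm}_{1,\beta}$ by identifying, for each $j=1,\dots,n$, the vertices $v_{(j-1)m+1},\dots,v_{jm}$ into a single vertex $w_j$, keeping all edges (so loops and multiple edges may occur). Two distinct half-edges are adjacent if they have the same endpoint. *)

(* Defs.v *)
From Stdlib Require Import Reals List Arith.
Import ListNotations.
Open Scope R_scope.

(* Kind of a choice f_{k+1}: (i,v) uniform, (i,h) head half-edge, (i,t) tail half-edge. *)
Inductive tag := TV | TH | TT.

(* Omega_{k+1} = {(i,v) : 1<=i<=k} u {(i,h),(i,t) : 2<=i<=k}  (k = current #vertices) *)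
Definition choices (k : nat) : list (nat * tag) :=
  map (fun i => (i, TV)) (seq 1 k) ++
  flat_map (fun i => [(i, TH); (i, TT)]) (seq 2 (k - 1)).

Definition choice_prob (beta : R) (k : nat) (c : nat * tag) : R :=
  match snd c with
  | TV => beta / ((2 + beta) * INR k - 2)
  | _ => 1 / ((2 + beta) * INR k - 2)
  end.

(* A tree G^N_{1,beta} is encoded by the list of heads of e_2, ..., e_N
   (the element at position i-2 is the index of the head of e_i; the tail of e_i is v_i). *)
Definition head_of (heads : list nat) (i : nat) : nat := nth (i - 2) heads 0%nat.

Definition target (heads : list nat) (c : nat * tag) : nat :=
  match snd c with
  | TV => fst c
  | TH => head_of heads (fst c)
  | TT => fst c
  end.

(* tree_dist k = law of G^{k+1}_{1,beta}, as a list of (outcome, probability) over all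
   trajectories (f_2, ..., f_{k+1}). *)
Fixpoint tree_dist (beta : R) (k : nat) : list (list nat * R) :=
  match k with
  | O => [([], 1)]
  | S k' =>
      flat_map (fun hp =>
        map (fun c => (fst hp ++ [target (fst hp) c], snd hp * choice_prob beta k c))
            (choices k))
        (tree_dist beta k')
  end.

Definition G1_dist (beta : R) (N : nat) : list (list nat * R) := tree_dist beta (N - 1).

(* In G^n_{m,beta}, v_i (1 <= i <= nm) belongs to w_j with j-1 = (i-1)/m. *)
Definition group (m i : nat) : nat := ((i - 1) / m)%nat.

(* degree of w_{j+1} (j < n): number of half-edges of e_2..e_{nm} whose endpoint lies in w_{j+1} *)
Definition degm (m n : nat) (heads : list nat) (j : nat) : nat :=
  fold_right plus 0%nat
    (map (fun i => ((if Nat.eqb (group m i) j then 1 else 0)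
                  + (if Nat.eqb (group m (head_of heads i)) j then 1 else 0))%nat)
         (seq 2 (n * m - 1))).

Definition binom2 (d : nat) : nat := (d * (d - 1) / 2)%nat.

Definition Dstat (m n : nat) (heads : list nat) : nat :=
  fold_right plus 0%nat (map (fun j => binom2 (degm m n heads j)) (seq 0 n)).

Definition expect (beta : R) (m n : nat) (X : list nat -> R) : R :=
  fold_right Rplus 0 (map (fun hp => snd hp * X (fst hp)) (G1_dist beta (n * m))).

Definition prob (beta : R) (m n : nat) (P : list nat -> Prop)
  (Pdec : forall h, {P h} + {~ P h}) : R :=
  fold_right Rplus 0
    (map (fun hp => if Pdec (fst hp) then snd hp else 0) (G1_dist beta (n * m))).

Definition ED (beta : R) (m n : nat) : R := expect beta m n (fun h => INR (Dstat m n h)).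

Definition dev_event (beta : R) (m n : nat) (eps : R) (h : list nat) : Prop :=
  Rpower (INR n) ((4 + beta) / (4 + 2 * beta) + eps) <= Rabs (INR (Dstat m n h) - ED beta m n).

Definition dev_event_dec (beta : R) (m n : nat) (eps : R) :
  forall h, {dev_event beta m n eps h} + {~ dev_event beta m n eps h} :=
  fun h => Rle_dec _ _.

(* Main.v *)
(* Follow Q, the sum of the squared degrees of the merged vertices, along the
   tree process, together with L, the degree of the merged vertex that is
   still being filled.  The conditional expectations of both are affine in
   (Q, L), so a suitable combination A_k Q_k + B_k L_k + const is a martingale
   ending at Q_N = 2 D + const, with A_k of order (N / k)^(2 theta) and B_k = O(A_k),
   where theta = 1 / (2 + beta).  Its k-th increment is at most A_k times the
   maximal degree at time k up to a constant.  Rising factorial moments of the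
   degrees show that, off an event of probability O(n^-gamma), all degrees at
   time k are at most n^delta k^theta, and then the squared increments sum to
   O(n^(1 + 2 theta + 2 delta)).  Chernoff's bound gives deviations of order
   n^(1/2 + theta + eps), and 1/2 + theta = (4 + beta) / (4 + 2 beta). *)

Require Import Defs.
From Stdlib Require Import Reals List Arith Lra Lia Psatz ClassicalEpsilon.
Import ListNotations.
Open Scope R_scope.

(** * Finite sums *)

Definition sumR {A : Type} (f : A -> R) (l : list A) : R := fold_right Rplus 0 (map f l).

Lemma sumR_cons {A} (f : A -> R) a l : sumR f (a :: l) = f a + sumR f l.
Proof. reflexivity. Qed.

Lemma sumR_app {A} (f : A -> R) l1 l2 : sumR f (l1 ++ l2) = sumR f l1 + sumR f l2.
Proof.
  induction l1 as [|a l1 IH]; simpl.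
  - unfold sumR; simpl; lra.
  - rewrite !sumR_cons, IH; lra.
Qed.

Lemma sumR_map {A B} (f : B -> R) (g : A -> B) l : sumR f (map g l) = sumR (fun x => f (g x)) l.
Proof. unfold sumR; rewrite map_map; reflexivity. Qed.

Lemma sumR_flat_map {A B} (f : B -> R) (g : A -> list B) l :
  sumR f (flat_map g l) = sumR (fun x => sumR f (g x)) l.
Proof.
  induction l as [|a l IH]; [reflexivity|].
  simpl; rewrite sumR_app, IH; reflexivity.
Qed.

Lemma sumR_ext {A} (f g : A -> R) l : (forall x, In x l -> f x = g x) -> sumR f l = sumR g l.
Proof.
  induction l as [|a l IH]; intros H; [reflexivity|].
  rewrite !sumR_cons, IH, (H a); simpl; auto.
  intros; apply H; simpl; auto.
Qed.

Lemma sumR_le {A} (f g : A -> R) l : (forall x, In x l -> f x <= g x) -> sumR f l <= sumR g l.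
Proof.
  induction l as [|a l IH]; intros H; [apply Rle_refl|].
  rewrite !sumR_cons. apply Rplus_le_compat; [apply H; simpl; auto|].
  apply IH; intros; apply H; simpl; auto.
Qed.

Lemma sumR_plus {A} (f g : A -> R) l : sumR (fun x => f x + g x) l = sumR f l + sumR g l.
Proof.
  induction l as [|a l IH]; [unfold sumR; simpl; lra|].
  rewrite !sumR_cons, IH; lra.
Qed.

Lemma sumR_scal {A} c (f : A -> R) l : sumR (fun x => c * f x) l = c * sumR f l.
Proof.
  induction l as [|a l IH]; [unfold sumR; simpl; lra|].
  rewrite !sumR_cons, IH; lra.
Qed.

Lemma sumR_const {A} c (l : list A) : sumR (fun _ => c) l = INR (length l) * c.
Proof.
  induction l as [|a l IH]; [unfold sumR; simpl; lra|].
  rewrite sumR_cons, IH. simpl length; rewrite S_INR; lra.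
Qed.

Lemma sumR_exchange {A B} (f : A -> B -> R) l1 l2 :
  sumR (fun x => sumR (f x) l2) l1 = sumR (fun y => sumR (fun x => f x y) l1) l2.
Proof.
  induction l1 as [|a l1 IH].
  - unfold sumR at 1; simpl. symmetry.
    transitivity (sumR (fun _ : B => 0) l2); [reflexivity|]. rewrite sumR_const; lra.
  - rewrite sumR_cons, IH, <- sumR_plus. reflexivity.
Qed.

Lemma sumR_term_le {A} (f : A -> R) l x :
  (forall y, In y l -> 0 <= f y) -> In x l -> f x <= sumR f l.
Proof.
  induction l as [|a l IH]; intros Hp [].
  - subst. rewrite sumR_cons.
    assert (sumR (fun _ => 0) l <= sumR f l) by (apply sumR_le; intros; apply Hp; simpl; auto).
    rewrite sumR_const in H; lra.
  - rewrite sumR_cons. assert (0 <= f a) by (apply Hp; simpl; auto).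
    assert (f x <= sumR f l) by (apply IH; auto; intros; apply Hp; simpl; auto). lra.
Qed.

Lemma sumR_nonneg {A} (f : A -> R) l : (forall x, In x l -> 0 <= f x) -> 0 <= sumR f l.
Proof.
  intros H. assert (sumR (fun _ => 0) l <= sumR f l) by (apply sumR_le; auto).
  rewrite sumR_const in H0; lra.
Qed.

Lemma INR_fold_plus {A} (f : A -> nat) l :
  INR (fold_right plus 0%nat (map f l)) = sumR (fun x => INR (f x)) l.
Proof.
  induction l as [|a l IH]; [reflexivity|].
  simpl map; simpl fold_right; rewrite plus_INR, IH; reflexivity.
Qed.

(** * The attachment step *)

(** Time is counted in edges: after [K] edges there are [K + 1] vertices, and the total weight of
    all choices is beta (K + 1) + 2 K. *)
Definition rate (beta : R) (K : nat) : R := / ((2 + beta) * INR (S K) - 2).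

(* Expectation of [g] at the target of the new edge; the tree [h] has [S K] vertices. *)
Definition step (beta : R) (K : nat) (h : list nat) (g : nat -> R) : R :=
  rate beta K * (beta * sumR g (seq 1 (S K)) +
                 sumR (fun i => g (head_of h i) + g i) (seq 2 K)).

Definition E (beta : R) (K : nat) (X : list nat -> R) : R :=
  sumR (fun hp => snd hp * X (fst hp)) (tree_dist beta K).

(** One entry per half-edge, so that degrees become sums over this list. *)
Definition ends (h : list nat) : list nat :=
  flat_map (fun i => [head_of h i; i]) (seq 2 (length h)).

(** Describes the support of the law: each head is a vertex already present. By [E_le] and [E_ext],
    random variables need only be compared on such lists. *)
Inductive valid : nat -> list nat -> Prop :=
| valid_nil : valid 0 []
| valid_snoc K h t : valid K h -> (1 <= t <= S K)%nat -> valid (S K) (h ++ [t]).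

Lemma E_0 beta X : E beta 0 X = X [].
Proof. unfold E, sumR; simpl; lra. Qed.

(** The tower property: the last choice is averaged first, with the tree built so far held fixed. *)
Lemma E_S beta K X :
  E beta (S K) X = E beta K (fun h => step beta K h (fun t => X (h ++ [t]))).
Proof.
  unfold E. cbn [tree_dist]. rewrite sumR_flat_map. apply sumR_ext. intros [h p] _.
  cbv beta. rewrite sumR_map. cbn [fst snd].
  transitivity (sumR (fun c => p * (choice_prob beta (S K) c * X (h ++ [target h c]))) (choices (S K))).
  { apply sumR_ext; intros; lra. }
  rewrite sumR_scal. f_equal.
  unfold choices. rewrite sumR_app, sumR_map, sumR_flat_map.
  replace (S K - 1)%nat with K by lia.
  unfold step. rewrite Rmult_plus_distr_l. f_equal.
  - rewrite <- !sumR_scal. apply sumR_ext; intros i _.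
    unfold choice_prob, target, rate; cbn [fst snd]. unfold Rdiv; ring.
  - rewrite <- !sumR_scal. apply sumR_ext; intros i _.
    unfold sumR, choice_prob, target, rate; cbn [fst snd map fold_right]. unfold Rdiv; ring.
Qed.

Lemma denom_pos beta K : 0 < beta -> beta <= (2 + beta) * INR (S K) - 2.
Proof. intros. rewrite S_INR. assert (0 <= INR K) by apply pos_INR. nra. Qed.

Lemma rate_pos beta K : 0 < beta -> 0 < rate beta K.
Proof. intros. apply Rinv_0_lt_compat. assert (h := denom_pos beta K H). lra. Qed.

Lemma rate_le beta K : 0 < beta -> rate beta K <= / beta.
Proof. intros. apply Rinv_le_contravar; auto. apply denom_pos; auto. Qed.

Lemma rate_denom beta K : 0 < beta -> rate beta K * (beta * INR (S K) + 2 * INR K) = 1.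
Proof.
  intros. unfold rate. assert (h := denom_pos beta K H).
  replace (beta * INR (S K) + 2 * INR K) with ((2 + beta) * INR (S K) - 2)
    by (rewrite S_INR; ring).
  apply Rinv_l. lra.
Qed.

Lemma step_plus beta K h f g :
  step beta K h (fun t => f t + g t) = step beta K h f + step beta K h g.
Proof.
  unfold step. rewrite sumR_plus.
  rewrite (sumR_ext (fun i => f (head_of h i) + g (head_of h i) + (f i + g i))
    (fun i => (f (head_of h i) + f i) + (g (head_of h i) + g i))) by (intros; lra).
  rewrite sumR_plus. ring.
Qed.

Lemma step_scal beta K h c g :
  step beta K h (fun t => c * g t) = c * step beta K h g.
Proof.
  unfold step. rewrite sumR_scal.
  rewrite (sumR_ext (fun i => c * g (head_of h i) + c * g i)
    (fun i => c * (g (head_of h i) + g i))) by (intros; lra).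
  rewrite sumR_scal. ring.
Qed.

Lemma step_const beta K h c : 0 < beta -> step beta K h (fun _ => c) = c.
Proof.
  intros. unfold step. rewrite !sumR_const, !length_seq.
  assert (h1 := rate_denom beta K H).
  replace (rate beta K * (beta * (INR (S K) * c) + INR K * (c + c)))
    with (rate beta K * (beta * INR (S K) + 2 * INR K) * c) by ring.
  rewrite h1; ring.
Qed.

Lemma in_ends h x :
  In x (ends h) <-> exists i, (2 <= i < 2 + length h)%nat /\ (x = head_of h i \/ x = i).
Proof.
  unfold ends. rewrite in_flat_map. split.
  - intros [i [Hi Hx]]. apply in_seq in Hi. exists i. split; [lia|]. simpl in Hx; intuition.
  - intros [i [Hi Hx]]. exists i. rewrite in_seq. split; [lia|]. simpl; intuition.
Qed.

Lemma ends_snoc h t : ends (h ++ [t]) = ends h ++ [t; (length h + 2)%nat].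
Proof.
  unfold ends. rewrite length_app. simpl length.
  rewrite Nat.add_1_r, seq_S, flat_map_app. f_equal.
  - rewrite !flat_map_concat_map. f_equal. apply map_ext_in. intros i Hi. apply in_seq in Hi.
    unfold head_of. rewrite app_nth1 by lia. reflexivity.
  - simpl. unfold head_of. replace (S (S (length h)) - 2)%nat with (length h) by lia.
    rewrite nth_middle. repeat f_equal. lia.
Qed.

Lemma valid_length K h : valid K h -> length h = K.
Proof. induction 1; [reflexivity|]. rewrite length_app; simpl; lia. Qed.

Lemma valid_ends K h x : valid K h -> In x (ends h) -> (1 <= x <= S K)%nat.
Proof.
  induction 1 as [|K h t Hv IH Ht]; [simpl; tauto|].
  rewrite ends_snoc, in_app_iff, (valid_length _ _ Hv). intros [H|H]; [apply IH in H; lia|].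
  simpl in H. lia.
Qed.

Lemma step_le beta K h f g : 0 < beta -> valid K h ->
  (forall t, (1 <= t <= S K)%nat -> f t <= g t) -> step beta K h f <= step beta K h g.
Proof.
  intros Hb Hv H. assert (Hl := valid_length _ _ Hv). unfold step. apply Rmult_le_compat_l; [left; apply rate_pos; auto|].
  apply Rplus_le_compat.
  - apply Rmult_le_compat_l; [lra|]. apply sumR_le. intros x Hx; apply in_seq in Hx; apply H; lia.
  - apply sumR_le. intros x Hx. apply in_seq in Hx. apply Rplus_le_compat; apply H; apply (valid_ends _ _ _ Hv);
    apply in_ends; exists x; split; auto; lia.
Qed.

Lemma step_ext beta K h f g : 0 < beta -> valid K h ->
  (forall t, (1 <= t <= S K)%nat -> f t = g t) -> step beta K h f = step beta K h g.
Proof. intros; apply Rle_antisym; apply step_le; auto; intros; rewrite H1; auto; lra. Qed.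

(** Peeling off the last step with [E_S] turns a comparison on lists of length [K + 1] into one on
    lists of length [K], so both random variables must be general in the induction. *)
Lemma E_le beta K X Y : 0 < beta ->
  (forall h, valid K h -> X h <= Y h) -> E beta K X <= E beta K Y.
Proof.
  intros Hb. revert X Y. induction K as [|K IH]; intros X Y H.
  - rewrite !E_0. apply H; constructor.
  - rewrite !E_S. apply IH. intros h Hv. apply step_le; auto.
    intros t Ht. apply H. constructor; auto.
Qed.

Lemma E_ext beta K X Y : 0 < beta ->
  (forall h, valid K h -> X h = Y h) -> E beta K X = E beta K Y.
Proof. intros; apply Rle_antisym; apply E_le; auto; intros; rewrite H0; auto; lra. Qed.

Lemma E_plus beta K X Y : E beta K (fun h => X h + Y h) = E beta K X + E beta K Y.
Proof.
  unfold E. rewrite <- sumR_plus. apply sumR_ext; intros; lra.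
Qed.

Lemma E_scal beta K c X : E beta K (fun h => c * X h) = c * E beta K X.
Proof.
  unfold E. rewrite <- sumR_scal. apply sumR_ext; intros; lra.
Qed.

Lemma E_const beta K c : 0 < beta -> E beta K (fun _ => c) = c.
Proof.
  intros Hb. induction K as [|K IH]; [apply E_0|].
  rewrite E_S. rewrite (E_ext _ _ _ (fun _ => c)); auto.
  intros; apply step_const; auto.
Qed.

(** * Degrees of groups and the pair statistic *)

Definition eqi (a b : nat) : R := if Nat.eqb a b then 1 else 0.

Definition deg (m : nat) (h : list nat) (j : nat) : R :=
  sumR (fun x => eqi (group m x) j) (ends h).

(** This is the sum of the squared degrees of the groups: a group of degree d contributes d
    half-edges, each with value d. *)
Definition sqdeg (m : nat) (h : list nat) : R :=
  sumR (fun x => deg m h (group m x)) (ends h).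

(** With [K] edges present the next vertex is v_{K+2}, whose group is (K + 2 - 1) / m. *)
Definition newgroup (m K : nat) : nat := ((K + 1) / m)%nat.

(* Degree of the group that the next vertex will join. *)
Definition opendeg (m : nat) (h : list nat) : R := deg m h (newgroup m (length h)).

Lemma eqi_bounds a b : 0 <= eqi a b <= 1.
Proof. unfold eqi; destruct (Nat.eqb a b); lra. Qed.

Lemma eqi_refl a : eqi a a = 1.
Proof. unfold eqi; rewrite Nat.eqb_refl; auto. Qed.

Lemma eqi_neq a b : a <> b -> eqi a b = 0.
Proof. intros; unfold eqi. apply Nat.eqb_neq in H. rewrite H; auto. Qed.

Lemma eqi_sym a b : eqi a b = eqi b a.
Proof. unfold eqi; rewrite Nat.eqb_sym; auto. Qed.

Lemma deg_nonneg m h j : 0 <= deg m h j.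
Proof. apply sumR_nonneg; intros; apply eqi_bounds. Qed.

Lemma group_new m (h : list nat) : group m (length h + 2) = newgroup m (length h).
Proof. unfold group, newgroup. f_equal. lia. Qed.

Lemma deg_snoc m h t j :
  deg m (h ++ [t]) j = deg m h j + eqi (group m t) j + eqi (newgroup m (length h)) j.
Proof.
  unfold deg. rewrite ends_snoc, sumR_app, !sumR_cons, group_new. unfold sumR at 2; simpl; ring.
Qed.

(** Raising a degree d by one adds 2 d + 1 to its square; this happens at the target's group and at
    the open group, and if the two coincide the cross term adds 2 more. *)
Lemma sqdeg_snoc m h t :
  sqdeg m (h ++ [t]) = sqdeg m h + 2 * deg m h (group m t) + 2 * opendeg m h + 2
                       + 2 * eqi (group m t) (newgroup m (length h)).
Proof.
  unfold sqdeg at 1. rewrite ends_snoc, sumR_app, !sumR_cons, group_new.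
  rewrite !deg_snoc.
  rewrite (sumR_ext _ (fun x => deg m h (group m x) +
     (eqi (group m x) (group m t) + eqi (group m x) (newgroup m (length h))))).
  2:{ intros x _. rewrite deg_snoc, (eqi_sym (group m t)), (eqi_sym (newgroup m _)). ring. }
  rewrite !sumR_plus.
  change (sumR (fun x => eqi (group m x) (group m t)) (ends h)) with (deg m h (group m t)).
  change (sumR (fun x => eqi (group m x) (newgroup m (length h))) (ends h)) with (opendeg m h).
  unfold sqdeg, sumR at 2. simpl. rewrite !eqi_refl, (eqi_sym (newgroup m _)).
  unfold opendeg. ring.
Qed.

(** Group [j] contains only vertices of index above j m, so only edges added from then on can touch
    it, each at most twice. *)
Lemma deg_le m K h j : (1 <= m)%nat -> valid K h -> deg m h j <= 2 * INR (S K - j * m).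
Proof.
  intros Hm. induction 1 as [|K h t Hv IH Ht].
  - change (deg m [] j) with 0. assert (H := pos_INR (1 - j * m)). lra.
  - rewrite deg_snoc, (valid_length _ _ Hv). unfold newgroup.
    destruct (le_lt_dec (S (S K)) (j * m)) as [Hj|Hj].
    + rewrite !eqi_neq.
      * replace (S (S K) - j * m)%nat with 0%nat by lia.
        replace (S K - j * m)%nat with 0%nat in IH by lia. lra.
      * intros He. assert (H := Nat.Div0.mul_div_le (K + 1) m). rewrite He in H. nia.
      * intros He. unfold group in He. assert (H := Nat.Div0.mul_div_le (t - 1) m).
        rewrite He in H. nia.
    + replace (S (S K) - j * m)%nat with (S (S K - j * m)) by lia. rewrite S_INR.
      assert (H1 := eqi_bounds (group m t) j). assert (H2 := eqi_bounds ((K + 1) / m)%nat j).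
      lra.
Qed.

Lemma deg_zero m K h j : (1 <= m)%nat -> valid K h -> (S K <= j * m)%nat -> deg m h j = 0.
Proof.
  intros Hm Hv Hj. assert (H := deg_le m K h j Hm Hv). assert (H' := deg_nonneg m h j).
  replace (S K - j * m)%nat with 0%nat in H by lia. simpl in H; lra.
Qed.

Lemma group_size m k j : (1 <= m)%nat ->
  sumR (fun i => eqi (group m i) j) (seq 1 k) = INR (min m (k - j * m)).
Proof.
  intros Hm. induction k as [|k IH].
  - rewrite Nat.sub_0_l, Nat.min_0_r. reflexivity.
  - rewrite seq_S, sumR_app, IH, sumR_cons. unfold sumR; simpl fold_right.
    unfold group. replace (1 + k - 1)%nat with k by lia.
    assert (H1 := Nat.div_mod_eq k m). assert (H2 := Nat.mod_upper_bound k m ltac:(lia)).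
    destruct (Nat.eq_dec (k / m) j) as [He|He].
    + rewrite He, eqi_refl, Rplus_0_r, <- S_INR. f_equal. nia.
    + rewrite eqi_neq by auto. rewrite !Rplus_0_r. f_equal.
      destruct (Nat.lt_trichotomy (k / m) j) as [Hl|[Hl|Hl]]; [|lia|].
      * assert (k < j * m)%nat by nia. lia.
      * assert (j * m + m <= k)%nat by nia. lia.
Qed.

Lemma group_size_le m k j : (1 <= m)%nat ->
  sumR (fun i => eqi (group m i) j) (seq 1 k) <= INR m.
Proof. intros. rewrite group_size by auto. apply le_INR. lia. Qed.

Lemma step_ends beta K h g : valid K h ->
  step beta K h g = rate beta K * (beta * sumR g (seq 1 (S K)) + sumR g (ends h)).
Proof.
  intros Hv. unfold step, ends. rewrite (valid_length _ _ Hv), sumR_flat_map.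
  do 2 f_equal. apply sumR_ext. intros. unfold sumR; simpl. ring.
Qed.

Lemma step_eqi beta m K h j : valid K h ->
  step beta K h (fun t => eqi (group m t) j) =
  rate beta K * (beta * sumR (fun i => eqi (group m i) j) (seq 1 (S K)) + deg m h j).
Proof. intros. rewrite step_ends by auto. reflexivity. Qed.

Lemma length_ends h : length (ends h) = (2 * length h)%nat.
Proof.
  unfold ends. rewrite (flat_map_constant_length (c := 2)); [rewrite length_seq; lia|reflexivity].
Qed.

(** After exchanging the sums, each half-edge counts the vertices present in its group: [m] for a
    full group, and [S K mod m] for the open one, whence the correction. *)
Lemma sum_deg_vertices m K h : (1 <= m)%nat -> valid K h ->
  sumR (fun i => deg m h (group m i)) (seq 1 (S K)) =
  2 * INR K * INR m - INR (m - S K mod m) * opendeg m h.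
Proof.
  intros Hm Hv. unfold deg. rewrite sumR_exchange.
  rewrite (sumR_ext _ (fun x => INR m + (- INR (m - S K mod m)) * eqi (group m x) (newgroup m K))).
  - rewrite sumR_plus, sumR_const, sumR_scal, length_ends, (valid_length _ _ Hv), mult_INR.
    unfold opendeg, deg. rewrite (valid_length _ _ Hv). simpl INR. ring.
  - intros x Hx. apply (valid_ends _ _ _ Hv) in Hx.
    rewrite (sumR_ext _ (fun i => eqi (group m i) (group m x))) by (intros; apply eqi_sym).
    rewrite group_size by auto. unfold newgroup, group. rewrite Nat.add_1_r.
    assert (H1 := Nat.div_mod_eq (S K) m). assert (H2 := Nat.mod_upper_bound (S K) m ltac:(lia)).
    assert (H3 := Nat.div_mod_eq (x - 1) m). assert (H4 := Nat.mod_upper_bound (x - 1) m ltac:(lia)).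
    destruct (Nat.eq_dec ((x - 1) / m) (S K / m)) as [He|He].
    + rewrite He, eqi_refl. replace (S K - S K / m * m)%nat with (S K mod m) by nia.
      rewrite Nat.min_r by lia. rewrite minus_INR by lia. ring.
    + rewrite eqi_neq by auto.
      assert ((x - 1) / m < S K / m)%nat by nia.
      rewrite Nat.min_l by nia. ring.
Qed.

(** * The affine recursion for squared degrees and its martingale *)

Definition stays_open (m K : nat) : R := if Nat.eqb (S (S K) mod m) 0 then 0 else 1.

(** If v_{K+2} completes its group, the vertex after it opens an empty group, of degree 0; this is
    the case in which [stays_open] vanishes. *)
Lemma opendeg_snoc m K h t : (1 <= m)%nat -> valid K h -> (1 <= t <= S K)%nat ->
  opendeg m (h ++ [t]) =
  stays_open m K * (opendeg m h + eqi (group m t) (newgroup m K) + 1).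
Proof.
  intros Hm Hv Ht. assert (Hl := valid_length _ _ Hv).
  unfold stays_open. destruct (Nat.eqb_spec (S (S K) mod m) 0) as [H|H].
  - rewrite Rmult_0_l. apply (deg_zero m (S K)); auto; [constructor; auto|].
    rewrite length_app, Hl. unfold newgroup. simpl length.
    replace (K + 1 + 1)%nat with (S (S K)) by lia.
    assert (H1 := Nat.div_mod_eq (S (S K)) m). nia.
  - unfold opendeg. rewrite length_app, Hl, deg_snoc, Hl. simpl length.
    assert (He : newgroup m (K + 1) = newgroup m K).
    { unfold newgroup. replace (K + 1 + 1)%nat with (S (S K)) by lia. rewrite Nat.add_1_r.
      assert (H1 := Nat.div_mod_eq (S (S K)) m).
      assert (H2 := Nat.mod_upper_bound (S (S K)) m ltac:(lia)).
      apply (Nat.div_unique (S K) m _ (S (S K) mod m - 1)); lia. }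
    rewrite He, eqi_refl. ring.
Qed.

(* Coefficient of [opendeg] in the conditional expectation of the next [sqdeg];
   the negative part corrects for the vertices missing from the open group. *)
Definition cross (beta : R) (m K : nat) : R :=
  2 + rate beta K * (2 - 2 * beta * INR (m - S K mod m)).

(** Here [d] is the number of steps still to come. With r = [rate beta K], one step maps the means
    of (Q, L) to ((1 + 2 r) Q + [cross] L, [stays_open] (1 + r) L) up to constants; [coefQ] and
    [coefL] pull the final Q back through these maps. *)
Fixpoint coefQ (beta : R) (d K : nat) : R :=
  match d with
  | O => 1
  | S d' => (1 + 2 * rate beta K) * coefQ beta d' (S K)
  end.

Fixpoint coefL (beta : R) (m d K : nat) : R :=
  match d with
  | O => 0
  | S d' => cross beta m K * coefQ beta d' (S K)
            + stays_open m K * (1 + rate beta K) * coefL beta m d' (S K)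
  end.

(* Up to an additive constant (see [drift]), the conditional expectation of [sqdeg] [d] steps later. *)
Definition forecast (beta : R) (m d : nat) (h : list nat) : R :=
  coefQ beta d (length h) * sqdeg m h + coefL beta m d (length h) * opendeg m h.

(* The part of the next forecast depending on the target [t]. *)
Definition innov (beta : R) (m d K : nat) (h : list nat) (t : nat) : R :=
  coefQ beta d (S K) * (2 * deg m h (group m t) + 2 * eqi (group m t) (newgroup m K))
  + coefL beta m d (S K) * stays_open m K * eqi (group m t) (newgroup m K).

(** Collects the terms of the conditional expectation that do not depend on the tree; [s] is the
    number of vertices already in the open group. *)
Definition drift (beta : R) (m d K : nat) : R :=
  let s := sumR (fun i => eqi (group m i) (newgroup m K)) (seq 1 (S K)) in
  coefQ beta d (S K) * (2 * rate beta K * beta * (2 * INR K * INR m)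
                        + 2 * (rate beta K * beta * s) + 2)
  + coefL beta m d (S K) * stays_open m K * (rate beta K * beta * s + 1).

Lemma forecast_snoc beta m d K h t : (1 <= m)%nat -> valid K h -> (1 <= t <= S K)%nat ->
  forecast beta m d (h ++ [t]) =
  innov beta m d K h t + (coefQ beta d (S K) * (sqdeg m h + 2 * opendeg m h + 2)
    + coefL beta m d (S K) * stays_open m K * (opendeg m h + 1)).
Proof.
  intros Hm Hv Ht. unfold forecast, innov.
  rewrite (opendeg_snoc m K), sqdeg_snoc by auto.
  rewrite length_app, (valid_length _ _ Hv). simpl length. rewrite Nat.add_1_r. ring.
Qed.

(** The martingale identity: together with [forecast_snoc], the mean of the next forecast is the
    current one plus a deterministic drift. The recursions for [coefQ] and [coefL] are made for
    this. *)
Lemma step_innov beta m d K h : 0 < beta -> (1 <= m)%nat -> valid K h ->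
  step beta K h (innov beta m d K h) =
  forecast beta m (S d) h + drift beta m d K -
  (coefQ beta d (S K) * (sqdeg m h + 2 * opendeg m h + 2)
    + coefL beta m d (S K) * stays_open m K * (opendeg m h + 1)).
Proof.
  intros Hb Hm Hv. unfold innov.
  rewrite step_plus, !step_scal, step_plus, !step_scal.
  rewrite step_eqi by auto. rewrite (step_ends _ _ _ (fun t => deg m h (group m t))) by auto.
  rewrite sum_deg_vertices by auto.
  change (sumR (fun t => deg m h (group m t)) (ends h)) with (sqdeg m h).
  unfold forecast, drift. rewrite (valid_length _ _ Hv). simpl coefQ; simpl coefL.
  unfold cross, opendeg. rewrite (valid_length _ _ Hv). ring.
Qed.

Lemma coefQ_pos beta d K : 0 < beta -> 0 < coefQ beta d K.
Proof.
  intros Hb. revert K. induction d as [|d IH]; intros K; simpl; [lra|].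
  assert (H := rate_pos beta K Hb). apply Rmult_lt_0_compat; [lra|auto].
Qed.

Definition crossbound (beta : R) (m : nat) : R := 2 + 2 / beta + 2 * INR m.

Lemma cross_abs beta m K : 0 < beta -> Rabs (cross beta m K) <= crossbound beta m.
Proof.
  intros Hb. unfold cross, crossbound.
  assert (H := rate_pos beta K Hb). assert (H1 := rate_le beta K Hb).
  assert (H2 : INR (m - S K mod m) <= INR m) by (apply le_INR; lia).
  assert (H3 : 0 <= INR (m - S K mod m)) by apply pos_INR.
  set (a := INR (m - S K mod m)) in *.
  assert (H4 : rate beta K * beta <= 1).
  { apply Rmult_le_compat_r with (r := beta) in H1; [|lra]. rewrite Rinv_l in H1; lra. }
  assert (H5 : 0 <= rate beta K * beta) by nra.
  assert (H6 : rate beta K * beta * a <= INR m).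
  { apply Rle_trans with (1 * a); [apply Rmult_le_compat_r; auto|lra]. }
  assert (H7 : 0 <= rate beta K * beta * a) by (apply Rmult_le_pos; auto).
  unfold Rdiv. apply Rabs_le. split; nra.
Qed.

(** The factor [m - S K mod m] counts the free places in the open group. The degree of that group is
    tracked by L only until they are filled, and each step until then contributes at most
    [crossbound] times [coefQ]. *)
Lemma coefL_abs beta m d K : 0 < beta -> (1 <= m)%nat ->
  Rabs (coefL beta m d K) <= crossbound beta m * INR (m - S K mod m) * coefQ beta d K.
Proof.
  intros Hb Hm. revert K. induction d as [|d IH]; intros K.
  - simpl. rewrite Rabs_R0. rewrite Rmult_1_r. apply Rmult_le_pos; [|apply pos_INR].
    eapply Rle_trans; [apply Rabs_pos | apply (cross_abs beta m 0 Hb)].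
  - simpl coefL; simpl coefQ. specialize (IH (S K)).
    assert (Hr := rate_pos beta K Hb). assert (Hq := coefQ_pos beta d (S K) Hb).
    assert (Hc := cross_abs beta m K Hb).
    assert (Hc0 : 0 <= crossbound beta m) by (eapply Rle_trans; [apply Rabs_pos | apply Hc]).
    set (q := coefQ beta d (S K)) in *. set (r := rate beta K) in *.
    set (C := crossbound beta m) in *.
    eapply Rle_trans; [apply Rabs_triang|]. rewrite !Rabs_mult.
    rewrite (Rabs_pos_eq q) by lra. rewrite (Rabs_pos_eq (1 + r)) by lra.
    assert (H1 : Rabs (cross beta m K) * q <= C * q) by (apply Rmult_le_compat_r; lra).
    assert (Hmod := Nat.mod_upper_bound (S K) m ltac:(lia)).
    unfold stays_open. destruct (Nat.eqb_spec (S (S K) mod m) 0) as [H|H].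
    (* The last free place is being filled, so nothing is carried over from later steps. *)
    + rewrite Rabs_R0.
      assert (1 <= INR (m - S K mod m)) by (apply (le_INR 1); lia).
      assert (C * q <= C * INR (m - S K mod m) * ((1 + 2 * r) * q)).
      { rewrite Rmult_assoc. apply Rmult_le_compat_l; auto.
        apply Rle_trans with (1 * ((1 + 2 * r) * q)); [nra|].
        apply Rmult_le_compat_r; nra. }
      lra.
    + rewrite Rabs_R1.
      assert (He : (S (S K) mod m = S (S K mod m))%nat).
      { assert (H2 := Nat.div_mod_eq (S (S K)) m).
        assert (H3 := Nat.mod_upper_bound (S (S K)) m ltac:(lia)).
        assert (H4 := Nat.mod_unique (S K) m (S (S K) / m) (S (S K) mod m - 1)
          ltac:(lia) ltac:(lia)). lia. }
      rewrite He in IH.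
      assert (H2 := Nat.mod_upper_bound (S (S K)) m ltac:(lia)).
      replace (m - S K mod m)%nat with (S (m - S (S K mod m))) by lia.
      rewrite S_INR. assert (H3 : 0 <= INR (m - S (S K mod m))) by apply pos_INR.
      set (y := INR (m - S (S K mod m))) in *.
      assert (1 * (1 + r) * Rabs (coefL beta m d (S K)) <= (1 + r) * (C * y * q)).
      { rewrite Rmult_1_l. apply Rmult_le_compat_l; lra. }
      assert (0 <= C * y * q * r) by (repeat apply Rmult_le_pos; lra).
      assert (0 <= C * q * r) by (repeat apply Rmult_le_pos; lra).
      nra.
Qed.

(** In [innov] the coefficient [coefL] multiplies only an indicator, so it costs a constant times
    [coefQ]; degrees enter through the [coefQ] term alone. *)
Lemma innov_abs beta m d K h t D : 0 < beta -> (1 <= m)%nat ->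
  (forall j, deg m h j <= D) ->
  Rabs (innov beta m d K h t) <=
  coefQ beta d (S K) * (2 * D + 2 + crossbound beta m * INR m).
Proof.
  intros Hb Hm HD. unfold innov.
  assert (Hq := coefQ_pos beta d (S K) Hb).
  assert (HL := coefL_abs beta m d (S K) Hb Hm).
  assert (Hc := cross_abs beta m 0 Hb).
  assert (Hc0 : 0 <= crossbound beta m) by (eapply Rle_trans; [apply Rabs_pos | apply Hc]).
  assert (Hl : INR (m - S (S K) mod m) <= INR m) by (apply le_INR; lia).
  set (q := coefQ beta d (S K)) in *. set (C := crossbound beta m) in *.
  assert (HL' : Rabs (coefL beta m d (S K)) <= C * INR m * q).
  { eapply Rle_trans; [apply HL|]. apply Rmult_le_compat_r; [lra|].
    apply Rmult_le_compat_l; auto. }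
  assert (He := eqi_bounds (group m t) (newgroup m K)).
  set (e := eqi (group m t) (newgroup m K)) in *.
  assert (Hd := HD (group m t)). assert (Hd' := deg_nonneg m h (group m t)).
  eapply Rle_trans; [apply Rabs_triang|]. rewrite !Rabs_mult.
  rewrite (Rabs_pos_eq q), (Rabs_pos_eq e) by lra.
  rewrite (Rabs_pos_eq (2 * _ + _)) by lra.
  assert (Hs : 0 <= Rabs (stays_open m K) <= 1).
  { unfold stays_open. destruct (Nat.eqb _ _); rewrite ?Rabs_R0, ?Rabs_R1; lra. }
  assert (Rabs (coefL beta m d (S K)) * Rabs (stays_open m K) * e <= C * INR m * q * 1 * 1).
  { apply Rmult_le_compat; try lra.
    - apply Rmult_le_pos; [apply Rabs_pos|lra].
    - apply Rmult_le_compat; try lra. apply Rabs_pos. }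
  assert (q * (2 * deg m h (group m t) + 2 * e) <= q * (2 * D + 2))
    by (apply Rmult_le_compat_l; lra).
  lra.
Qed.

Lemma E_forecast_S beta m d K : 0 < beta -> (1 <= m)%nat ->
  E beta (S K) (forecast beta m d) = E beta K (forecast beta m (S d)) + drift beta m d K.
Proof.
  intros Hb Hm. rewrite E_S.
  rewrite <- (E_const beta K (drift beta m d K)) by auto. rewrite <- E_plus.
  apply E_ext; auto. intros h Hv.
  rewrite (step_ext _ _ _ _ _ Hb Hv (fun t Ht => forecast_snoc beta m d K h t Hm Hv Ht)).
  rewrite step_plus, step_const, step_innov by auto. ring.
Qed.

(** * Exponential moments on the event of moderate degrees *)

Definition indic (P : Prop) : R := if excluded_middle_informative P then 1 else 0.

Lemma indic_true P : P -> indic P = 1.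
Proof. intros; unfold indic; destruct excluded_middle_informative; tauto. Qed.

Lemma indic_false P : ~ P -> indic P = 0.
Proof. intros; unfold indic; destruct excluded_middle_informative; tauto. Qed.

Lemma indic_bounds P : 0 <= indic P <= 1.
Proof. unfold indic; destruct excluded_middle_informative; lra. Qed.

(** The bound is imposed on the whole history, [firstn K h] being the tree at time [K]. Hence the
    event can only shrink as time passes. *)
Definition moderate (m : nat) (bd : nat -> R) (h : list nat) : Prop :=
  forall K, (K <= length h)%nat -> forall j, deg m (firstn K h) j <= bd K.

Lemma moderate_deg m bd h j : moderate m bd h -> deg m h j <= bd (length h).
Proof. intros H. specialize (H (length h) (le_n _) j). rewrite firstn_all in H. auto. Qed.

Lemma moderate_snoc m bd h t :
  moderate m bd (h ++ [t]) <->
  moderate m bd h /\ forall j, deg m (h ++ [t]) j <= bd (S (length h)).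
Proof.
  assert (Hl : length (h ++ [t]) = S (length h)) by (rewrite length_app; simpl; lia).
  split.
  - intros H. split.
    + intros K HK j. specialize (H K ltac:(lia) j).
      rewrite firstn_app in H. replace (K - length h)%nat with 0%nat in H by lia.
      simpl in H. rewrite app_nil_r in H. auto.
    + intros j. apply (moderate_deg _ _ _ j) in H. rewrite Hl in H. auto.
  - intros [H1 H2] K HK j. rewrite Hl in HK.
    destruct (Nat.eq_dec K (S (length h))) as [->|Hn].
    + rewrite <- Hl at 1. rewrite firstn_all. auto.
    + rewrite firstn_app. replace (K - length h)%nat with 0%nat by lia.
      simpl. rewrite app_nil_r. apply H1. lia.
Qed.

Lemma exp_le_quadratic x : x <= 1 -> exp x <= 1 + x + 2 * x ^ 2.
Proof.
  intros Hx.
  assert (H : 1 - x / 2 <= exp (- (x / 2))).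
  { assert (h := exp_ineq1_le (- (x / 2))). lra. }
  assert (H2 : (1 - x / 2) ^ 2 * exp x <= 1).
  { replace 1 with (exp (- (x / 2)) * exp (- (x / 2)) * exp x) at 2.
    - apply Rmult_le_compat_r; [left; apply exp_pos|]. nra.
    - rewrite <- !exp_plus. replace (- (x / 2) + - (x / 2) + x) with 0 by field. apply exp_0. }
  (* The right side minus 1 equals x^2 (1 - x) (5 - 2 x) / 4. *)
  assert (H3 : 1 <= (1 - x / 2) ^ 2 * (1 + x + 2 * x ^ 2)).
  { assert (0 <= x ^ 2 * ((1 - x) * (5 - 2 * x))).
    { apply Rmult_le_pos; [apply pow2_ge_0|]. apply Rmult_le_pos; lra. }
    nra. }
  assert (0 < (1 - x / 2) ^ 2) by (apply pow_lt; lra).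
  apply Rmult_le_reg_l with ((1 - x / 2) ^ 2); lra.
Qed.

(** Valid for every real x; the linear term disappears when a centred variable is averaged, which
    leaves a subgaussian bound. *)
Lemma exp_le_subgauss x : exp x <= x + exp (2 * x ^ 2).
Proof.
  destruct (Rle_dec x 1) as [H|H].
  - assert (h1 := exp_le_quadratic x H). assert (h2 := exp_ineq1_le (2 * x ^ 2)). lra.
  - assert (exp x <= exp (2 * x ^ 2)).
    { left. apply exp_increasing. nra. }
    lra.
Qed.

Lemma exp_le x y : x <= y -> exp x <= exp y.
Proof. intros [H| ->]; [left; apply exp_increasing; auto|lra]. Qed.

(** The mean of [g] also has absolute value at most [c], so [g] deviates from it by at most 2 c, and
    2 lam^2 (2 c)^2 = 8 lam^2 c^2. *)
Lemma step_mgf beta K h g lam c : 0 < beta -> valid K h ->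
  (forall t, (1 <= t <= S K)%nat -> Rabs (g t) <= c) ->
  step beta K h (fun t => exp (lam * (g t - step beta K h g))) <= exp (8 * lam ^ 2 * c ^ 2).
Proof.
  intros Hb Hv Hg. set (a := step beta K h g).
  assert (Ha : Rabs a <= c).
  { apply Rabs_le. split.
    - rewrite <- (step_const beta K h (- c)) by auto. apply step_le; auto.
      intros t Ht. apply Hg in Ht. revert Ht; unfold Rabs; destruct Rcase_abs; lra.
    - rewrite <- (step_const beta K h c) by auto. apply step_le; auto.
      intros t Ht. apply Hg in Ht. revert Ht; unfold Rabs; destruct Rcase_abs; lra. }
  apply Rle_trans with
    (step beta K h (fun t => lam * (g t + - a) + exp (8 * lam ^ 2 * c ^ 2))).
  - apply step_le; auto. intros t Ht. apply Hg in Ht.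
    eapply Rle_trans; [apply exp_le_subgauss|]. apply Rplus_le_compat; [right; ring|].
    apply exp_le. replace (2 * (lam * (g t - a)) ^ 2) with (2 * lam ^ 2 * (g t - a) ^ 2) by ring.
    replace (8 * lam ^ 2 * c ^ 2) with (2 * lam ^ 2 * (2 * c) ^ 2) by ring.
    apply Rmult_le_compat_l; [assert (h0 := pow2_ge_0 lam); lra|].
    rewrite <- (Rsqr_pow2 (g t - a)), <- (Rsqr_pow2 (2 * c)). apply Rsqr_le_abs_1.
    unfold Rminus. eapply Rle_trans; [apply Rabs_triang|]. rewrite Rabs_Ropp.
    eapply Rle_trans; [|apply Rle_abs]. lra.
  - rewrite step_plus, step_scal, step_plus, !step_const by auto. fold a. right; ring.
Qed.

Definition innov_bound (beta : R) (m : nat) (bd : nat -> R) (T K : nat) : R :=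
  coefQ beta (T - S K) (S K) * (2 * bd K + 2 + crossbound beta m * INR m).

(** An Azuma-type induction. On a moderate history the next increment obeys [step_mgf], and the
    indicator at the next time is bounded by 1; on any other history all extensions are immoderate
    and contribute 0. *)
Lemma forecast_mgf beta m bd lam T K : 0 < beta -> (1 <= m)%nat -> (K <= T)%nat ->
  E beta K (fun h => indic (moderate m bd h) *
    exp (lam * (forecast beta m (T - K) h - E beta K (forecast beta m (T - K)))))
  <= exp (8 * lam ^ 2 * sumR (fun i => innov_bound beta m bd T i ^ 2) (seq 0 K)).
Proof.
  intros Hb Hm. induction K as [|K IH]; intros HK.
  - rewrite !E_0, Rminus_diag. unfold sumR; simpl. rewrite !Rmult_0_r, exp_0.
    assert (H := indic_bounds (moderate m bd [])). lra.
  - specialize (IH ltac:(lia)).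
    rewrite seq_S, sumR_app, sumR_cons. unfold sumR at 2; simpl fold_right. rewrite Nat.add_0_l, Rplus_0_r.
    rewrite Rmult_plus_distr_l, exp_plus, E_S, E_forecast_S by auto.
    replace (T - K)%nat with (S (T - S K)) in IH by lia.
    set (d := (T - S K)%nat) in *. set (mu := E beta K (forecast beta m (S d))) in *.
    set (v := exp (8 * lam ^ 2 * innov_bound beta m bd T K ^ 2)).
    eapply Rle_trans with (E beta K (fun h => v * (indic (moderate m bd h) *
      exp (lam * (forecast beta m (S d) h - mu))))).
    + apply E_le; auto. intros h Hv. assert (Hl := valid_length _ _ Hv).
      destruct (classic (moderate m bd h)) as [Hg|Hg].
      * rewrite (indic_true _ Hg), Rmult_1_l.
        apply Rle_trans with (step beta K h (fun t => exp (lam * (forecast beta m (S d) h - mu)) *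
          exp (lam * (innov beta m d K h t - step beta K h (innov beta m d K h))))).
        -- apply step_le; auto. intros t Ht.
           assert (H := indic_bounds (moderate m bd (h ++ [t]))).
           apply Rle_trans with (1 * exp (lam * (forecast beta m d (h ++ [t]) - (mu + drift beta m d K)))).
           ++ apply Rmult_le_compat_r; [left; apply exp_pos|lra].
           ++ rewrite Rmult_1_l, <- exp_plus. apply exp_le. right.
              rewrite (forecast_snoc beta m d K), step_innov by auto. ring.
        -- rewrite step_scal, Rmult_comm. apply Rmult_le_compat_r; [left; apply exp_pos|].
           unfold v, innov_bound. apply step_mgf; auto. intros t Ht.
           apply innov_abs; auto. intros j. rewrite <- Hl. apply moderate_deg; auto.
      * rewrite (indic_false _ Hg), Rmult_0_l, Rmult_0_r.
        rewrite <- (step_const beta K h 0) by auto. apply step_le; auto.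
        intros t Ht. rewrite indic_false; [lra|]. rewrite moderate_snoc. tauto.
    + rewrite E_scal, Rmult_comm. apply Rmult_le_compat_r; [left; apply exp_pos|]. exact IH.
Qed.

(** * Degree moments *)

Fixpoint rising (p : nat) (x : R) : R :=
  match p with O => 1 | S p' => rising p' x * (x + INR p') end.

(** This is why rising factorials replace powers: if x jumps to x + 1 with probability r x, the mean
    of [rising p] is multiplied by exactly 1 + p r. *)
Lemma rising_shift p x : rising p (x + 1) * x = rising p x * (x + INR p).
Proof.
  induction p as [|p IH]; [simpl; ring|].
  cbn [rising]. rewrite S_INR.
  replace (rising p (x + 1) * (x + 1 + INR p) * x)
    with (rising p (x + 1) * x * (x + 1 + INR p)) by ring.
  rewrite IH. ring.
Qed.

Lemma rising_ge_pow p x : 0 <= x -> x ^ p <= rising p x.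
Proof.
  intros Hx. induction p as [|p IH]; [simpl; lra|].
  cbn [rising pow]. rewrite Rmult_comm. assert (H := pos_INR p).
  apply Rmult_le_compat; auto; [apply pow_le; auto|lra].
Qed.

Lemma rising_nonneg p x : 0 <= x -> 0 <= rising p x.
Proof. intros. eapply Rle_trans; [|apply rising_ge_pow; auto]. apply pow_le; auto. Qed.

Lemma rising_le p x y : 0 <= x -> x <= y -> rising p x <= rising p y.
Proof.
  intros Hx Hy. induction p as [|p IH]; [simpl; lra|].
  cbn [rising]. assert (H := pos_INR p).
  apply Rmult_le_compat; auto; [apply rising_nonneg; auto|lra|lra].
Qed.

Fixpoint growth (beta p : R) (K : nat) : R :=
  match K with O => 1 | S K' => growth beta p K' * (1 + p * rate beta K') end.

Lemma growth_ge_1 beta p K : 0 < beta -> 0 <= p -> 1 <= growth beta p K.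
Proof.
  intros Hb Hp. induction K as [|K IH]; simpl; [lra|].
  assert (H := rate_pos beta K Hb). assert (0 <= p * rate beta K) by nra. nra.
Qed.

(** The shift by beta m absorbs the uniform choices: the group holds at most [m] vertices, so it is
    hit with probability at most [rate] times the shifted degree. *)
Lemma deg_moment beta m p K j : 0 < beta -> (1 <= m)%nat ->
  E beta K (fun h => rising p (deg m h j + beta * INR m))
  <= rising p (2 * INR m + beta * INR m) * growth beta (INR p) K.
Proof.
  intros Hb Hm. assert (HM : 1 <= INR m) by (apply (le_INR 1); auto).
  assert (HbM : 0 < beta * INR m) by nra.
  assert (Hp := pos_INR p).
  set (C := rising p (2 * INR m + beta * INR m)).
  assert (HC : 0 <= C) by (apply rising_nonneg; lra).
  induction K as [|K IH].
  - rewrite E_0. simpl growth. rewrite Rmult_1_r. apply rising_le.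
    + assert (H := deg_nonneg m [] j). lra.
    + change (deg m [] j) with 0. lra.
  (* If the vertex being added lies in group [j], the degree is still at most 2 m, whatever happened
     before. Otherwise the degree can rise only through the target. *)
  - destruct (Nat.eq_dec j (newgroup m K)) as [Hj|Hj].
    + assert (Hg := growth_ge_1 beta (INR p) (S K) Hb Hp).
      apply Rle_trans with (E beta (S K) (fun _ => C)).
      * apply E_le; auto. intros h Hv. assert (H := deg_nonneg m h j). apply rising_le; [lra|].
        assert (H1 := deg_le m (S K) h j Hm Hv).
        assert (INR (S (S K) - j * m) <= INR m); [|lra].
        apply le_INR. subst j. unfold newgroup.
        assert (H2 := Nat.div_mod_eq (K + 1) m).
        assert (H3 := Nat.mod_upper_bound (K + 1) m ltac:(lia)). nia.
      * rewrite E_const by auto. rewrite <- (Rmult_1_r C) at 1. apply Rmult_le_compat_l; auto.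
    + rewrite E_S. simpl growth.
      apply Rle_trans with (E beta K (fun h => (1 + INR p * rate beta K) *
        rising p (deg m h j + beta * INR m))).
      * apply E_le; auto. intros h Hv. assert (Hx := deg_nonneg m h j).
        set (x := deg m h j + beta * INR m).
        assert (Hx0 : 0 < x) by (unfold x; lra).
        rewrite (step_ext _ _ _ _ (fun t => rising p x + (rising p (x + 1) - rising p x)
          * eqi (group m t) j)); auto.
        2:{ intros t Ht. rewrite deg_snoc, (valid_length _ _ Hv).
            rewrite (eqi_neq (newgroup m K)) by auto.
            unfold eqi. destruct (Nat.eqb _ _).
            - replace (deg m h j + 1 + 0 + beta * INR m) with (x + 1) by (unfold x; ring). ring.
            - replace (deg m h j + 0 + 0 + beta * INR m) with x by (unfold x; ring). ring. }
        rewrite step_plus, step_const, step_scal, step_eqi by auto.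
        assert (Hs := group_size_le m (S K) j Hm).
        set (s := sumR _ _) in *.
        assert (Hd : 0 <= rising p (x + 1) - rising p x).
        { assert (H := rising_le p x (x + 1) ltac:(lra) ltac:(lra)). lra. }
        assert (H1 := rising_shift p x). assert (Hr := rate_pos beta K Hb).
        assert (H2 : beta * s + deg m h j <= x) by (unfold x; nra).
        assert (H3 : (rising p (x + 1) - rising p x) * (rate beta K * (beta * s + deg m h j))
          <= (rising p (x + 1) - rising p x) * (rate beta K * x)).
        { apply Rmult_le_compat_l; auto. apply Rmult_le_compat_l; lra. }
        replace ((rising p (x + 1) - rising p x) * (rate beta K * x))
          with (rate beta K * (rising p (x + 1) * x - rising p x * x)) in H3 by ring.
        rewrite H1 in H3. lra.
      * rewrite E_scal. replace (C * (growth beta (INR p) K * (1 + INR p * rate beta K)))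
          with ((1 + INR p * rate beta K) * (C * growth beta (INR p) K)) by ring.
        apply Rmult_le_compat_l; auto. assert (Hr := rate_pos beta K Hb). nra.
Qed.

Lemma deg_tail beta m p K j b : 0 < beta -> (1 <= m)%nat -> 0 < b ->
  E beta K (fun h => indic (b < deg m h j))
  <= rising p (2 * INR m + beta * INR m) * growth beta (INR p) K / b ^ p.
Proof.
  intros Hb Hm Hb0. assert (HM : 1 <= INR m) by (apply (le_INR 1); auto).
  assert (Hbp : 0 < b ^ p) by (apply pow_lt; auto).
  apply Rle_trans with (E beta K (fun h => / b ^ p * rising p (deg m h j + beta * INR m))).
  - apply E_le; auto. intros h Hv. assert (Hx := deg_nonneg m h j).
    assert (Hx0 : 0 <= deg m h j + beta * INR m) by nra.
    apply Rmult_le_reg_l with (b ^ p); auto. rewrite <- Rmult_assoc, Rinv_r, Rmult_1_l by lra.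
    assert (Hr := rising_nonneg p _ Hx0).
    unfold indic. destruct excluded_middle_informative as [H|H]; [|lra].
    rewrite Rmult_1_r. eapply Rle_trans; [|apply rising_ge_pow; auto].
    apply pow_incr. nra.
  - rewrite E_scal. unfold Rdiv. rewrite Rmult_comm. apply Rmult_le_compat_r.
    + left. apply Rinv_0_lt_compat; auto.
    + apply deg_moment; auto.
Qed.

(** A union bound over [K + 1] times and [J] groups. *)
Lemma immoderate_prob beta m bd eta J K : 0 < beta -> (1 <= m)%nat ->
  (forall i, 0 <= bd i) -> (S K <= J)%nat -> 0 <= eta ->
  (forall i j, (i <= K)%nat -> E beta i (fun h => indic (bd i < deg m h j)) <= eta) ->
  E beta K (fun h => 1 - indic (moderate m bd h)) <= INR (S K) * (INR J * eta).
Proof.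
  intros Hb Hm Hbd.
  assert (Hcur : forall i, (S i <= J)%nat -> 0 <= eta ->
    (forall j, E beta i (fun h => indic (bd i < deg m h j)) <= eta) ->
    E beta i (fun h => indic (exists j, bd i < deg m h j)) <= INR J * eta).
  { intros i Hi Heta H.
    apply Rle_trans with (E beta i (fun h => sumR (fun j => indic (bd i < deg m h j)) (seq 0 J))).
    - apply E_le; auto. intros h Hv.
      destruct (classic (exists j, bd i < deg m h j)) as [He|He].
      + rewrite indic_true by auto. destruct He as [j Hj]. rewrite <- (indic_true _ Hj).
        apply (sumR_term_le (fun j => indic (bd i < deg m h j))).
        * intros; apply indic_bounds.
        * apply in_seq. split; [lia|].
          destruct (le_lt_dec (0 + J) j) as [HJ|]; auto.
          (* Groups of index [J] or more have not begun, so their degree 0 cannot exceed the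
             bound. *)
          rewrite (deg_zero m i) in Hj by (auto; nia). specialize (Hbd i). lra.
      + rewrite indic_false by auto. apply sumR_nonneg. intros; apply indic_bounds.
    - unfold E at 1.
      rewrite (sumR_ext _ (fun hp => sumR (fun j => snd hp * indic (bd i < deg m (fst hp) j)) (seq 0 J)))
        by (intros; rewrite sumR_scal; auto).
      rewrite sumR_exchange. replace (INR J * eta) with (sumR (fun _ : nat => eta) (seq 0 J)) by (rewrite sumR_const, length_seq; auto).
      apply sumR_le. intros j _. apply H. }
  induction K as [|K IH]; intros HJ Heta H.
  - rewrite E_0. rewrite indic_true.
    + simpl INR. assert (0 <= INR J * eta) by (apply Rmult_le_pos; auto; apply pos_INR). lra.
    + intros i Hi j. destruct i; [|simpl in Hi; lia]. apply Hbd.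
  - assert (IH' : E beta K (fun h => 1 - indic (moderate m bd h)) <= INR (S K) * (INR J * eta))
      by (apply IH; auto; lia).
    rewrite (S_INR (S K)), Rmult_plus_distr_r, Rmult_1_l.
    (* Moderation fails either already at time [K] or for the first time at [S K]. *)
    apply Rle_trans with (E beta (S K) (fun h => (1 - indic (moderate m bd (firstn K h))) +
      indic (exists j, bd (S K) < deg m h j))).
    + rewrite !E_S. apply E_le; auto. intros h Hv. apply step_le; auto. intros t Ht.
      assert (Hl := valid_length _ _ Hv).
      rewrite firstn_app, <- Hl, firstn_all, Nat.sub_diag. simpl firstn. rewrite app_nil_r.
      assert (b1 := indic_bounds (moderate m bd h)).
      assert (b2 := indic_bounds (exists j, bd (S (length h)) < deg m (h ++ [t]) j)).
      destruct (classic (moderate m bd (h ++ [t]))) as [Hg|Hg].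
      * rewrite (indic_true _ Hg). lra.
      * rewrite (indic_false _ Hg). rewrite moderate_snoc in Hg.
        destruct (classic (moderate m bd h)) as [Hg'|Hg'].
        -- rewrite (indic_true (exists j, _)); [lra|].
           apply NNPP. intros Hn. apply Hg. split; auto. intros j. apply Rnot_lt_le.
           intros Hlt. apply Hn. exists j; auto.
        -- rewrite (indic_false _ Hg'). lra.
    + rewrite E_plus. apply Rplus_le_compat.
      * rewrite E_S. eapply Rle_trans; [|apply IH']. apply E_le; auto. intros h Hv.
        rewrite <- (step_const beta K h (1 - indic (moderate m bd h))) by auto.
        apply step_le; auto. intros t Ht.
        rewrite firstn_app, <- (valid_length _ _ Hv), firstn_all, Nat.sub_diag.
        simpl firstn. rewrite app_nil_r. lra.
      * apply Hcur; auto.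
Qed.

(** * Power bounds *)

Lemma Rpower_pos x y : 0 < Rpower x y.
Proof. apply exp_pos. Qed.

Lemma Rpower_ge_1 x y : 1 <= x -> 0 <= y -> 1 <= Rpower x y.
Proof.
  intros. rewrite <- (Rpower_O x) by lra. apply Rle_Rpower; lra.
Qed.

Lemma Rpower_1_l y : Rpower 1 y = 1.
Proof. unfold Rpower. rewrite ln_1, Rmult_0_r. apply exp_0. Qed.

Lemma Rpower_pow_l x y n : Rpower x y ^ n = Rpower x (y * INR n).
Proof. rewrite <- Rpower_pow by apply Rpower_pos. apply Rpower_mult. Qed.

Lemma Rpower_inv_l x y : 0 < x -> Rpower (/ x) y = Rpower x (- y).
Proof. intros. unfold Rpower. rewrite ln_Rinv by auto. f_equal. ring. Qed.

Lemma bernoulli_Rpower u s : 0 < u -> 0 <= s <= 1 -> Rpower u s <= 1 + s * (u - 1).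
Proof.
  intros Hu Hs. set (y := 1 + s * (u - 1)).
  assert (Hy : 0 < y).
  { unfold y. destruct (Req_dec s 1) as [->|]; [lra|]. assert (0 <= s * u) by nra. nra. }
  assert (Hln : forall z, 0 < z -> ln z <= z - 1).
  { intros z Hz. assert (H := exp_ineq1_le (ln z)). rewrite exp_ln in H; lra. }
  assert (H1 := Hln (u / y) (Rdiv_lt_0_compat _ _ Hu Hy)).
  assert (H2 := Hln (/ y) (Rinv_0_lt_compat _ Hy)).
  unfold Rdiv in H1. rewrite ln_mult in H1 by (auto; apply Rinv_0_lt_compat; auto).
  rewrite ln_Rinv in * by auto.
  (* Weighting the bounds on ln (u / y) and ln (1 / y) by s and 1 - s makes their right sides
     cancel, which gives s ln u <= ln y. *)
  assert (H3 : s * (u * / y) + (1 - s) * / y = 1) by (unfold y; field; fold y; lra).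
  rewrite <- (exp_ln y Hy). apply exp_le. nra.
Qed.

Lemma INR_S_pos K : 0 < INR (S K).
Proof. apply lt_0_INR; lia. Qed.

Lemma INR_ge_1 K : (1 <= K)%nat -> 1 <= INR K.
Proof. intros. apply (le_INR 1); auto. Qed.

(** The growth exponent of the degree of a fixed vertex. *)
Definition theta (beta : R) : R := / (2 + beta).

Lemma theta_bounds beta : 0 < beta -> 0 < theta beta /\ 2 * theta beta < 1.
Proof.
  intros. unfold theta. split; [apply Rinv_0_lt_compat; lra|].
  apply Rmult_lt_reg_r with (2 + beta); [lra|].
  rewrite Rmult_assoc, Rinv_l; lra.
Qed.

(** The factor 1 + 2 [rate beta K] is exactly the inverse of 1 - 2 theta / (K + 1), and Bernoulli's
    inequality bounds (K / (K + 1))^(2 theta) by the latter. Products of these factors then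
    telescope. *)
Lemma rate_factor_le beta K : 0 < beta -> (1 <= K)%nat ->
  1 + 2 * rate beta K <= Rpower (INR (S K) / INR K) (2 * theta beta).
Proof.
  intros Hb HK. assert (HK1 := INR_ge_1 K HK). assert (Ht := theta_bounds beta Hb).
  assert (Hd := denom_pos beta K Hb). assert (Hr := rate_pos beta K Hb).
  assert (HS := INR_S_pos K).
  assert (Hu : 0 < INR K / INR (S K)) by (apply Rdiv_lt_0_compat; lra).
  assert (Hu' : 0 < INR (S K) / INR K) by (apply Rdiv_lt_0_compat; lra).
  assert (H := bernoulli_Rpower (INR K / INR (S K)) (2 * theta beta) Hu ltac:(lra)).
  apply Rmult_le_reg_r with (Rpower (INR K / INR (S K)) (2 * theta beta)); [apply Rpower_pos|].
  rewrite Rpower_mult_distr by auto.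
  replace (INR (S K) / INR K * (INR K / INR (S K))) with 1 by (field; lra).
  rewrite Rpower_1_l.
  eapply Rle_trans; [apply Rmult_le_compat_l; [lra|apply H]|].
  right. unfold rate, theta. rewrite S_INR in *. field. lra.
Qed.

Lemma coefQ_le beta d K : 0 < beta -> (1 <= K)%nat ->
  coefQ beta d K <= Rpower (INR (K + d) / INR K) (2 * theta beta).
Proof.
  intros Hb. revert K. induction d as [|d IH]; intros K HK; assert (HK1 := INR_ge_1 K HK).
  - simpl. rewrite Nat.add_0_r. unfold Rdiv. rewrite Rinv_r by lra. rewrite Rpower_1_l; lra.
  - cbn [coefQ]. assert (HS := INR_S_pos K).
    assert (HT : 0 < INR (S K + d)) by (apply lt_0_INR; lia).
    replace (INR (K + S d) / INR K) with (INR (S K) / INR K * (INR (S K + d) / INR (S K))).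
    2:{ replace (K + S d)%nat with (S K + d)%nat by lia. field. lra. }
    rewrite <- Rpower_mult_distr; try (apply Rdiv_lt_0_compat; lra).
    assert (Hr := rate_pos beta K Hb). assert (Hq := coefQ_pos beta d (S K) Hb).
    apply Rmult_le_compat; try lra.
    + apply rate_factor_le; auto.
    + apply IH; lia.
Qed.

Lemma growth_2_le beta K : 0 < beta ->
  growth beta 2 K <= (1 + 2 / beta) * Rpower (INR (S K)) (2 * theta beta).
Proof.
  intros Hb. assert (Ht := theta_bounds beta Hb).
  assert (Hb2 : 0 < 2 / beta) by (apply Rdiv_lt_0_compat; lra).
  destruct K as [|K].
  { simpl. rewrite Rpower_1_l. lra. }
  assert (H : growth beta 2 (S K) <= (1 + 2 / beta) * Rpower (INR (S K)) (2 * theta beta)).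
  { induction K as [|K IH].
    (* The factor at time 0 lies outside [rate_factor_le]; it is the source of the constant 1 + 2 /
       beta. *)
    - simpl INR. rewrite Rpower_1_l. cbn [growth]. assert (H := rate_le beta 0 Hb).
      unfold Rdiv. lra.
    - cbn [growth] in *. set (g := growth beta 2 K * (1 + 2 * rate beta K)) in *.
      assert (Hr := rate_pos beta (S K) Hb). assert (HS := INR_S_pos K). assert (HS' := INR_S_pos (S K)).
      assert (H := rate_factor_le beta (S K) Hb ltac:(lia)).
      replace (INR (S (S K))) with (INR (S K) * (INR (S (S K)) / INR (S K))) by (field; lra).
      rewrite <- Rpower_mult_distr by (auto; apply Rdiv_lt_0_compat; lra).
      rewrite <- Rmult_assoc. apply Rmult_le_compat; auto; [|lra].
      unfold g. assert (H1 := growth_ge_1 beta 2 (S K) Hb ltac:(lra)). cbn [growth] in H1. lra. }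
  eapply Rle_trans; [apply H|]. apply Rmult_le_compat_l; [lra|].
  apply Rle_Rpower_l; [lra|]. split; [apply INR_S_pos|]. apply le_INR; lia.
Qed.

(** By Bernoulli, 1 + 2 q r <= (1 + 2 r)^q factor by factor, so all even moments reduce to the
    exponent 2 theta of the case p = 2. *)
Lemma growth_even_le beta q K : 0 < beta ->
  growth beta (INR (2 * q)) K <= growth beta 2 K ^ q.
Proof.
  intros Hb. induction K as [|K IH].
  - simpl growth. rewrite pow1. lra.
  - cbn [growth]. rewrite Rpow_mult_distr. assert (Hr := rate_pos beta K Hb).
    assert (Hp := pos_INR (2 * q)).
    assert (H := growth_ge_1 beta (INR (2 * q)) K Hb Hp).
    apply Rmult_le_compat; auto; try nra.
    eapply Rle_trans; [|apply poly; lra]. rewrite mult_INR. simpl (INR 2). right; ring.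
Qed.

(** A discrete integral comparison: Bernoulli gives (1 - s) (K + 1)^(-s) <= (K + 1)^(1 - s) - K^(1 -
    s). *)
Lemma sum_inverse_powers s K : 0 <= s < 1 -> (1 <= K)%nat ->
  sumR (fun i => Rpower (INR (S i)) (- s)) (seq 0 K) <= Rpower (INR K) (1 - s) / (1 - s).
Proof.
  intros Hs HK. induction HK as [|K HK IH].
  - unfold sumR; simpl. rewrite !Rpower_1_l, Rplus_0_r.
    apply Rmult_le_reg_r with (1 - s); [lra|]. unfold Rdiv. rewrite Rmult_assoc, Rinv_l; lra.
  - rewrite seq_S, sumR_app, sumR_cons. unfold sumR at 2; simpl fold_right.
    rewrite Nat.add_0_l, Rplus_0_r.
    assert (HK1 := INR_ge_1 K HK). assert (HS := INR_S_pos K).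
    assert (Hu : 0 < INR K / INR (S K)) by (apply Rdiv_lt_0_compat; lra).
    assert (H := bernoulli_Rpower (INR K / INR (S K)) (1 - s) Hu ltac:(lra)).
    assert (Hp := Rpower_pos (INR (S K)) (1 - s)).
    apply Rmult_le_compat_r with (r := Rpower (INR (S K)) (1 - s)) in H; [|lra].
    rewrite Rpower_mult_distr in H by auto.
    replace (INR K / INR (S K) * INR (S K)) with (INR K) in H by (field; lra).
    assert (He : Rpower (INR (S K)) (- s) = Rpower (INR (S K)) (1 - s) * / INR (S K)).
    { unfold Rminus. rewrite Rpower_plus, Rpower_1 by auto. field. lra. }
    rewrite He. apply Rmult_le_reg_r with (1 - s); [lra|].
    apply Rmult_le_compat_r with (r := 1 - s) in IH; [|lra].
    unfold Rdiv in IH |- *. rewrite Rmult_assoc, Rinv_l, Rmult_1_r in IH by lra.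
    rewrite (Rmult_assoc _ (/ (1 - s)) (1 - s)), Rinv_l, Rmult_1_r by lra.
    set (P := Rpower (INR (S K)) (1 - s)) in *.
    replace ((1 + (1 - s) * (INR K / INR (S K) - 1)) * P)
      with (P - P * / INR (S K) * (1 - s)) in H; [lra|].
    assert (Hk : INR K = INR (S K) - 1) by (rewrite S_INR; ring). rewrite Hk. field. lra.
Qed.

Definition degbound (beta x : R) (i : nat) : R := x * Rpower (INR (S i)) (theta beta).

(** With k = i + 1, the i-th term is at most a constant times x^2 (T / k)^(4 theta) k^(2 theta) =
    x^2 T^(4 theta) k^(-2 theta). Since 2 theta < 1, the sum over k is of order T^(1 - 2 theta). *)
Lemma sum_innov_bound beta m x T : 0 < beta -> (1 <= m)%nat -> 1 <= x -> (1 <= T)%nat ->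
  sumR (fun i => innov_bound beta m (degbound beta x) T i ^ 2) (seq 0 T) <=
  (4 + crossbound beta m * INR m) ^ 2 * x ^ 2 * (Rpower (INR T) (1 + 2 * theta beta) / (1 - 2 * theta beta)).
Proof.
  intros Hb Hm Hx HT. assert (Ht := theta_bounds beta Hb). set (th := theta beta) in *.
  assert (HM := INR_ge_1 m Hm). assert (HT1 := INR_ge_1 T HT).
  assert (Hc : 0 <= crossbound beta m).
  { eapply Rle_trans; [apply Rabs_pos | apply (cross_abs beta m 0 Hb)]. }
  assert (HcM : 0 <= crossbound beta m * INR m) by nra.
  set (C := 4 + crossbound beta m * INR m).
  apply Rle_trans with (sumR (fun i => C ^ 2 * x ^ 2 * Rpower (INR T) (4 * th) *
    Rpower (INR (S i)) (- (2 * th))) (seq 0 T)).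
  - apply sumR_le. intros i Hi. apply in_seq in Hi. unfold innov_bound.
    assert (Hq := coefQ_le beta (T - S i) (S i) Hb ltac:(lia)). fold th in Hq.
    replace (S i + (T - S i))%nat with T in Hq by lia.
    assert (Hq0 := coefQ_pos beta (T - S i) (S i) Hb).
    assert (Hi1 := INR_S_pos i). assert (Hi2 := INR_ge_1 (S i) ltac:(lia)).
    assert (Hp := Rpower_ge_1 (INR (S i)) th Hi2 ltac:(lra)).
    (* As the degree bound is at least 1, the additive constants can be absorbed into the factor
       [C]. *)
    assert (Hbd : 1 <= degbound beta x i) by (unfold degbound; fold th; nra).
    set (b := degbound beta x i) in *.
    apply Rle_trans with ((Rpower (INR T / INR (S i)) (2 * th) * (C * b)) ^ 2).
    + assert (Hb2 : 2 * b + 2 + crossbound beta m * INR m <= C * b).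
      { assert (0 <= (b - 1) * (crossbound beta m * INR m)) by (apply Rmult_le_pos; lra).
        unfold C. lra. }
      apply pow_incr. split.
      * apply Rmult_le_pos; lra.
      * apply Rmult_le_compat; lra.
    + right. unfold b, degbound. fold th. unfold Rdiv.
      rewrite <- Rpower_mult_distr by (try apply Rinv_0_lt_compat; lra).
      rewrite !Rpow_mult_distr, !Rpower_pow_l. replace (INR 2) with 2 by (simpl; ring).
      rewrite Rpower_inv_l by lra.
      replace (2 * th * 2) with (4 * th) by ring.
      transitivity (C ^ 2 * x ^ 2 * Rpower (INR T) (4 * th) *
        (Rpower (INR (S i)) (- (4 * th)) * Rpower (INR (S i)) (th * 2))); [ring|].
      rewrite <- Rpower_plus. do 2 f_equal. ring.
  - rewrite sumR_scal. rewrite Rmult_assoc.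
    assert (H := sum_inverse_powers (2 * th) T ltac:(lra) HT).
    apply Rmult_le_compat_l; [assert (h1 := pow2_ge_0 C); assert (h2 := pow2_ge_0 x); nra|].
    replace (1 + 2 * th) with (4 * th + (1 - 2 * th)) by ring.
    rewrite Rpower_plus. unfold Rdiv. rewrite Rmult_assoc.
    apply Rmult_le_compat_l; [left; apply Rpower_pos|]. exact H.
Qed.

(** The moment of order 2 q grows at most like (i + 1)^(2 q theta), just as the power of the degree
    bound does, so the estimate is uniform in time. *)
Lemma deg_tail_degbound beta m q x i j : 0 < beta -> (1 <= m)%nat -> 0 < x ->
  E beta i (fun h => indic (degbound beta x i < deg m h j))
  <= rising (2 * q) (2 * INR m + beta * INR m) * (1 + 2 / beta) ^ q / x ^ (2 * q).
Proof.
  intros Hb Hm Hx. assert (Hp := Rpower_pos (INR (S i)) (theta beta)).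
  assert (Hbd : 0 < degbound beta x i) by (unfold degbound; nra).
  assert (HM := INR_ge_1 m Hm).
  assert (HR : 0 <= rising (2 * q) (2 * INR m + beta * INR m)) by (apply rising_nonneg; nra).
  eapply Rle_trans; [apply (deg_tail beta m (2 * q)); auto|].
  assert (Hg : growth beta (INR (2 * q)) i <=
    (1 + 2 / beta) ^ q * Rpower (INR (S i)) (theta beta) ^ (2 * q)).
  { eapply Rle_trans; [apply growth_even_le; auto|].
    rewrite pow_mult, <- Rpow_mult_distr. apply pow_incr. split.
    - assert (h := growth_ge_1 beta 2 i Hb). lra.
    - eapply Rle_trans; [apply growth_2_le; auto|]. right. rewrite Rpower_pow_l.
      replace (INR 2) with 2 by (simpl; ring). do 2 f_equal. ring. }
  unfold degbound. rewrite Rpow_mult_distr.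
  set (P := Rpower (INR (S i)) (theta beta) ^ (2 * q)) in *.
  assert (HP : 0 < P) by (apply pow_lt; auto).
  assert (Hxp : 0 < x ^ (2 * q)) by (apply pow_lt; auto).
  set (R0 := rising _ _) in *.
  apply Rle_trans with (R0 * ((1 + 2 / beta) ^ q * P) / (x ^ (2 * q) * P)).
  - apply Rmult_le_compat_r; [left; apply Rinv_0_lt_compat; nra|].
    apply Rmult_le_compat_l; auto.
  - right. field. lra.
Qed.

(** Raise x / r <= exp (x / r) to the power r and invert. *)
Lemma exp_neg_le_pow x r : 0 < x -> (1 <= r)%nat -> exp (- x) <= INR r ^ r / x ^ r.
Proof.
  intros Hx Hr. assert (Hr1 := INR_ge_1 r Hr).
  assert (Hxr : 0 < x / INR r) by (apply Rdiv_lt_0_compat; lra).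
  assert (H : (x / INR r) ^ r <= exp x).
  { replace x with (INR r * (x / INR r)) at 2 by (field; lra).
    rewrite <- Rpower_pow by auto. unfold Rpower. apply exp_le. apply Rmult_le_compat_l; [lra|].
    assert (h := exp_ineq1_le (ln (x / INR r))). rewrite exp_ln in h; lra. }
  rewrite exp_Ropp. assert (Hp : 0 < x ^ r) by (apply pow_lt; auto).
  assert (Hrp : 0 < INR r ^ r) by (apply pow_lt; lra).
  unfold Rdiv in H. rewrite Rpow_mult_distr, pow_inv in H.
  apply Rinv_le_contravar in H.
  - eapply Rle_trans; [apply H|]. right. field. lra.
  - apply Rmult_lt_0_compat; auto. apply Rinv_0_lt_compat; auto.
Qed.

(** * The statistic [Dstat] *)

Lemma INR_binom2 d : INR (binom2 d) = INR d * (INR d - 1) / 2.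
Proof.
  unfold binom2. destruct d as [|d]; [simpl; field|].
  (* Evenness makes the division of natural numbers by 2 exact. *)
  assert (He : Nat.Even (S d * (S d - 1))).
  { replace (S d - 1)%nat with d by lia. destruct (Nat.Even_or_Odd d) as [[k Hk]|[k Hk]].
    - exists (S d * k)%nat. rewrite Hk at 2. ring.
    - exists (S k * d)%nat. rewrite Hk at 1. ring. }
  destruct He as [k Hk]. rewrite Hk, Nat.mul_comm, Nat.div_mul by lia.
  replace (INR (S d) - 1) with (INR (S d - 1)) by (rewrite minus_INR by lia; simpl; ring).
  rewrite <- mult_INR, Hk, mult_INR. simpl (INR 2). field.
Qed.

Lemma INR_degm m n h j : length h = (n * m - 1)%nat -> INR (degm m n h j) = deg m h j.
Proof.
  intros Hl. unfold degm, deg, ends. rewrite INR_fold_plus, sumR_flat_map, Hl.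
  apply sumR_ext. intros i _. rewrite plus_INR. unfold sumR, eqi; simpl.
  destruct (Nat.eqb _ _), (Nat.eqb _ _); simpl; ring.
Qed.

Lemma sumR_eqi (f : nat -> R) n k : (k < n)%nat -> sumR (fun j => eqi k j * f j) (seq 0 n) = f k.
Proof.
  intros Hk. induction n as [|n IH]; [lia|].
  rewrite seq_S, sumR_app, sumR_cons. unfold sumR at 2; simpl fold_right. rewrite Nat.add_0_l.
  destruct (Nat.eq_dec k n) as [->|Hn].
  - rewrite eqi_refl, (sumR_ext _ (fun _ => 0)).
    + rewrite sumR_const. ring.
    + intros j Hj. apply in_seq in Hj. rewrite eqi_neq by lia. ring.
  - rewrite IH, eqi_neq by lia. ring.
Qed.

(** Each binomial coefficient is (d^2 - d) / 2, and the degrees sum to twice the number of edges. *)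
Lemma Dstat_sqdeg m n h : (1 <= m)%nat -> (1 <= n)%nat -> valid (n * m - 1) h ->
  INR (Dstat m n h) = sqdeg m h / 2 - INR (n * m - 1).
Proof.
  intros Hm Hn Hv. assert (Hl := valid_length _ _ Hv).
  assert (Hg : forall x, In x (ends h) -> (group m x < n)%nat).
  { intros x Hx. apply (valid_ends _ _ _ Hv) in Hx. unfold group.
    apply Nat.Div0.div_lt_upper_bound. nia. }
  unfold Dstat. rewrite INR_fold_plus.
  rewrite (sumR_ext _ (fun j => / 2 * (deg m h j * deg m h j) + - / 2 * deg m h j)).
  2:{ intros j _. rewrite INR_binom2, INR_degm by auto. field. }
  rewrite sumR_plus, !sumR_scal.
  (* A sum over groups weighted by degree is a sum over half-edges; it serves with f the degree and
     with f = 1. *)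
  assert (Hsum : forall f : nat -> R, sumR (fun j => deg m h j * f j) (seq 0 n) =
     sumR (fun x => f (group m x)) (ends h)).
  { intros f.
    rewrite (sumR_ext _ (fun j => sumR (fun x => eqi (group m x) j * f j) (ends h))).
    - rewrite sumR_exchange. apply sumR_ext. intros x Hx. apply sumR_eqi; auto.
    - intros j _. rewrite (sumR_ext (fun x => eqi (group m x) j * f j)
        (fun x => f j * eqi (group m x) j)) by (intros; ring).
      rewrite sumR_scal. unfold deg. ring. }
  rewrite (Hsum (deg m h)).
  rewrite (sumR_ext (deg m h) (fun j => deg m h j * 1)) by (intros; ring).
  rewrite (Hsum (fun _ => 1)), sumR_const, length_ends, Hl, mult_INR.
  fold (sqdeg m h). simpl (INR 2). field.
Qed.

Lemma prob_E beta m n P Pdec : prob beta m n P Pdec = E beta (n * m - 1) (fun h => indic (P h)).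
Proof.
  unfold prob, E, G1_dist. apply sumR_ext. intros [h p] _. simpl.
  unfold indic. destruct Pdec, excluded_middle_informative; try tauto; ring.
Qed.

Lemma ED_sqdeg beta m n : 0 < beta -> (1 <= m)%nat -> (1 <= n)%nat ->
  ED beta m n = E beta (n * m - 1) (sqdeg m) / 2 - INR (n * m - 1).
Proof.
  intros Hb Hm Hn. change (ED beta m n) with (E beta (n * m - 1) (fun h => INR (Dstat m n h))).
  rewrite (E_ext _ _ _ (fun h => / 2 * sqdeg m h + - INR (n * m - 1))); auto.
  - rewrite E_plus, E_scal, E_const by auto. field.
  - intros h Hv. rewrite Dstat_sqdeg by auto. field.
Qed.

Lemma forecast_0 beta m h : forecast beta m 0 h = sqdeg m h.
Proof. unfold forecast; simpl; ring. Qed.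

(* Chernoff's bound for both tails on the event of moderate degrees. *)
Lemma sqdeg_deviation beta m bd T lam s : 0 < beta -> (1 <= m)%nat -> 0 <= lam ->
  E beta T (fun h => indic (s <= Rabs (sqdeg m h - E beta T (sqdeg m)))) <=
  E beta T (fun h => 1 - indic (moderate m bd h)) +
  2 * exp (8 * lam ^ 2 * sumR (fun i => innov_bound beta m bd T i ^ 2) (seq 0 T)) * exp (- (lam * s)).
Proof.
  intros Hb Hm Hlam. set (mu := E beta T (sqdeg m)).
  set (V := exp (8 * _ * _)).
  assert (Hmgf : forall l, l ^ 2 = lam ^ 2 ->
    E beta T (fun h => indic (moderate m bd h) * exp (l * (sqdeg m h - mu))) <= V).
  { intros l Hl. assert (H := forecast_mgf beta m bd l T T Hb Hm (le_n _)).
    rewrite Nat.sub_diag, Hl in H. fold V in H.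
    assert (Hmu : E beta T (forecast beta m 0) = mu)
      by (apply E_ext; auto; intros; apply forecast_0).
    rewrite Hmu in H. eapply Rle_trans; [|apply H]. right. apply E_ext; auto.
    intros. rewrite forecast_0. reflexivity. }
  assert (H1 := Hmgf lam eq_refl). assert (H2 := Hmgf (- lam) ltac:(ring)).
  (* Off the moderate event the first term is already 1; on it, a deviation of size [s] makes one of
     the two exponentials at least exp (lam s). *)
  apply Rle_trans with (E beta T (fun h => (1 - indic (moderate m bd h)) + exp (- (lam * s)) *
    (indic (moderate m bd h) * exp (lam * (sqdeg m h - mu)) +
     indic (moderate m bd h) * exp (- lam * (sqdeg m h - mu))))).
  - apply E_le; auto. intros h _.
    assert (b := indic_bounds (s <= Rabs (sqdeg m h - mu))).
    set (z := sqdeg m h - mu) in *.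
    destruct (classic (moderate m bd h)) as [Hg|Hg].
    + rewrite (indic_true _ Hg), !Rmult_1_l.
      rewrite Rmult_plus_distr_l, <- !exp_plus.
      assert (p1 := exp_pos (- (lam * s) + lam * z)). assert (p2 := exp_pos (- (lam * s) + - lam * z)).
      destruct (Rle_dec s (Rabs z)) as [Hs|Hs]; [|rewrite (indic_false _ Hs); lra].
      rewrite (indic_true _ Hs).
      destruct (Rle_dec 0 z).
      * rewrite Rabs_pos_eq in Hs by lra.
        assert (h1 := exp_ineq1_le (- (lam * s) + lam * z)). nra.
      * rewrite Rabs_left in Hs by lra.
        assert (h1 := exp_ineq1_le (- (lam * s) + - lam * z)). nra.
    + rewrite (indic_false _ Hg). lra.
  - rewrite E_plus, E_scal, E_plus. apply Rplus_le_compat_l.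
    assert (p := exp_pos (- (lam * s))). nra.
Qed.

(** * Choice of the parameters and conclusion *)

Theorem theorem9 (beta : R) (m : nat) (hbeta : 0 < beta) (hm : (1 <= m)%nat)
  (eps gamma : R) (heps : 0 < eps) (hgamma : 0 < gamma) :
  exists nstar : nat, forall n : nat, (nstar <= n)%nat ->
    prob beta m n (dev_event beta m n eps) (dev_event_dec beta m n eps)
      <= Rpower (INR n) (- gamma).
Proof.
  assert (Ht := theta_bounds beta hbeta). set (th := theta beta) in *.
  (* The failure bound will be C n^2 / n^(q eps): n^2 comes from the union bound, and one more
     factor n will absorb C, whence gamma + 3. *)
  destruct (INR_unbounded ((gamma + 3) / eps)) as [q Hq].
  assert (Hqe : gamma + 3 <= INR q * eps).
  { apply Rmult_lt_compat_r with (r := eps) in Hq; auto.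
    unfold Rdiv in Hq. rewrite Rmult_assoc, Rinv_l in Hq; lra. }
  assert (Hq1 : (1 <= q)%nat).
  { destruct q; [simpl in Hqe; lra|lia]. }
  set (Rb := rising (2 * q) (2 * INR m + beta * INR m) * (1 + 2 / beta) ^ q).
  set (V := (4 + crossbound beta m * INR m) ^ 2 * (Rpower (INR m) (1 + 2 * th) / (1 - 2 * th))).
  set (C := INR m ^ 2 * Rb + 2 * exp (8 * V) * INR (2 * q) ^ (2 * q)).
  assert (HM := INR_ge_1 m hm).
  assert (HRb : 0 <= Rb).
  { apply Rmult_le_pos; [apply rising_nonneg; nra|]. apply pow_le.
    assert (0 < 2 / beta) by (apply Rdiv_lt_0_compat; lra). lra. }
  destruct (INR_unbounded C) as [n0 Hn0].
  (* Taking n >= n0 gives C <= n, and n >= 2 ensures [T >= 1]. *)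
  exists (n0 + 2)%nat. intros n Hn.
  assert (HnC : C <= INR n). { assert (INR n0 <= INR n) by (apply le_INR; lia). lra. }
  assert (Hn1 := INR_ge_1 n ltac:(lia)).
  set (x := Rpower (INR n) (eps / 2)).
  assert (Hx : 1 <= x) by (apply Rpower_ge_1; lra).
  set (T := (n * m - 1)%nat). assert (HST : S T = (n * m)%nat) by (unfold T; nia).
  assert (HT : (1 <= T)%nat) by (unfold T; nia).
  (* Chosen so that lam^2 x^2 n^(1 + 2 theta) = 1, which keeps the exponential moment bounded, while
     lam s = 2 x still grows as a power of n. *)
  set (lam := Rpower (INR n) (- (1 / 2 + th + eps / 2))).
  assert (Hlam : 0 < lam) by apply Rpower_pos.
  (* The factor 2 appears because D is half of [sqdeg] up to a constant. *)
  set (s := 2 * Rpower (INR n) (1 / 2 + th + eps)).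
  assert (Hls : lam * s = 2 * x).
  { unfold lam, s, x. rewrite <- Rmult_assoc, (Rmult_comm _ 2), Rmult_assoc, <- Rpower_plus.
    do 2 f_equal. field. }
  rewrite prob_E. fold T.
  apply Rle_trans with (E beta T (fun h => indic (s <= Rabs (sqdeg m h - E beta T (sqdeg m))))).
  { apply E_le; auto. intros h Hv.
    destruct (classic (dev_event beta m n eps h)) as [He|He].
    2:{ rewrite indic_false by auto. apply indic_bounds. }
    rewrite !indic_true; [lra| |auto]. unfold dev_event in He.
    rewrite ED_sqdeg, Dstat_sqdeg in He by (auto; lia). fold T in He.
    replace ((4 + beta) / (4 + 2 * beta) + eps) with (1 / 2 + th + eps) in He
      by (unfold th, theta; field; lra).
    replace (sqdeg m h / 2 - INR T - (E beta T (sqdeg m) / 2 - INR T))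
      with (/ 2 * (sqdeg m h - E beta T (sqdeg m))) in He by field.
    rewrite Rabs_mult, (Rabs_pos_eq (/ 2)) in He by lra. unfold s. lra. }
  eapply Rle_trans.
  { apply (sqdeg_deviation beta m (degbound beta x) T lam s); auto. lra. }
  assert (Hx2 : 0 < x ^ (2 * q)) by (apply pow_lt; lra).
  assert (Hbad : E beta T (fun h => 1 - indic (moderate m (degbound beta x) h)) <=
    INR n ^ 2 * (INR m ^ 2 * Rb) / x ^ (2 * q)).
  { eapply Rle_trans.
    - apply (immoderate_prob beta m (degbound beta x) (Rb / x ^ (2 * q)) (S T) T); auto.
      + intros i. unfold degbound. assert (h := Rpower_pos (INR (S i)) (theta beta)). nra.
      + unfold Rdiv. apply Rmult_le_pos; auto. left. apply Rinv_0_lt_compat; auto.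
      + intros i j _. apply deg_tail_degbound; auto. lra.
    - rewrite HST, mult_INR. right. field. lra. }
  assert (Hexp : exp (8 * lam ^ 2 *
     sumR (fun i => innov_bound beta m (degbound beta x) T i ^ 2) (seq 0 T)) <= exp (8 * V)).
  { apply exp_le. rewrite Rmult_assoc. apply Rmult_le_compat_l; [lra|].
    apply Rle_trans with (lam ^ 2 * ((4 + crossbound beta m * INR m) ^ 2 * x ^ 2 *
      (Rpower (INR n * INR m) (1 + 2 * th) / (1 - 2 * th)))).
    - apply Rmult_le_compat_l; [apply pow2_ge_0|].
      eapply Rle_trans; [apply sum_innov_bound; auto|]. fold th.
      apply Rmult_le_compat_l.
      + apply Rmult_le_pos; apply pow2_ge_0.
      + apply Rmult_le_compat_r; [left; apply Rinv_0_lt_compat; lra|].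
        apply Rle_Rpower_l; [lra|]. split; [apply lt_0_INR; lia|].
        rewrite <- mult_INR. apply le_INR. lia.
    - rewrite <- Rpower_mult_distr by lra.
      assert (H1 : lam ^ 2 * (x ^ 2 * Rpower (INR n) (1 + 2 * th)) = 1).
      { unfold lam, x. rewrite !Rpower_pow_l, <- !Rpower_plus. simpl INR.
        replace (_ + _) with 0 by field. apply Rpower_O. lra. }
      right. unfold V.
      transitivity ((lam ^ 2 * (x ^ 2 * Rpower (INR n) (1 + 2 * th))) *
        ((4 + crossbound beta m * INR m) ^ 2 * (Rpower (INR m) (1 + 2 * th) / (1 - 2 * th))));
        [unfold Rdiv; ring|]. rewrite H1. ring. }
  (* The spare factor n^2 gives this term the same form as [Hbad]. *)
  assert (Htail : exp (- (lam * s)) <= INR n ^ 2 * (INR (2 * q) ^ (2 * q) / x ^ (2 * q))).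
  { rewrite Hls. apply Rle_trans with (exp (- x)); [apply exp_le; lra|].
    assert (H := exp_neg_le_pow x (2 * q) ltac:(lra) ltac:(lia)).
    assert (0 < exp (- x)) by apply exp_pos. assert (1 <= INR n ^ 2) by nra. nra. }
  apply Rle_trans with (C * (INR n ^ 2 / x ^ (2 * q))).
  { unfold C. rewrite Rmult_plus_distr_r.
    apply Rplus_le_compat; [eapply Rle_trans; [apply Hbad|right; field; lra]|].
    apply Rle_trans with (2 * exp (8 * V) * (INR n ^ 2 * (INR (2 * q) ^ (2 * q) / x ^ (2 * q)))).
    - apply Rmult_le_compat; auto.
      + assert (h := exp_pos (8 * lam ^ 2 *
          sumR (fun i => innov_bound beta m (degbound beta x) T i ^ 2) (seq 0 T))). lra.
      + left; apply exp_pos.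
      + lra.
    - right. field. lra. }
  apply Rle_trans with (INR n * (INR n ^ 2 / x ^ (2 * q))).
  { apply Rmult_le_compat_r; auto. apply Rmult_le_pos; [apply pow2_ge_0|].
    left; apply Rinv_0_lt_compat; auto. }
  unfold x. rewrite Rpower_pow_l, mult_INR. replace (INR 2) with 2 by (simpl; ring).
  replace (INR n * (INR n ^ 2 / Rpower (INR n) (eps / 2 * (2 * INR q))))
    with (INR n ^ 3 * / Rpower (INR n) (eps / 2 * (2 * INR q))) by (unfold Rdiv; ring).
  (* The remaining exponent is 3 - q eps, at most -gamma by the choice of [q]. *)
  rewrite <- Rpower_Ropp, <- Rpower_pow by lra. rewrite <- Rpower_plus.
  apply Rle_Rpower; auto. simpl INR. lra.
Qed.
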